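(* There exist tilings of the plane with pairwise noncongruent triangles of unit perimeter, the areas of which are bounded from below by a positive constant. That is, there exist a constant $\varepsilon>0$ and a family $\mathcal{T}$ of closed nondegenerate triangles in $\mathbb{R}^2$ such that $\bigcup_{T\in\mathcal{T}}T=\mathbb{R}^2$, distinct members of $\mathcal{T}$ have disjoint interiors, no two distinct members of $\mathcal{T}$ are congruent, every $T\in\mathcal{T}$ has perimeter $1$, and every $T\in\mathcal{T}$ has area at least $\varepsilon$.
   Context: A tiling of the plane is a covering of the plane with closed regions whose interiors are pairwise disjoint. (It is not required that the tiling be edge-to-edge.) Two triangles are congruent if some isometry of the plane, possibly orientation-reversing, maps one onto the other. *)

(* Defs.v *)
From HB Require Import structures.
From mathcomp Require Export all_boot all_order all_algebra.
From mathcomp Require Export all_classical all_reals all_analysis.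

Set Implicit Arguments.
Unset Strict Implicit.
Unset Printing Implicit Defensive.

Import Order.TTheory GRing.Theory Num.Theory.
Import numFieldNormedType.Exports.

Local Open Scope classical_set_scope.
Local Open Scope ring_scope.

(* The plane is R * R with its product topology. *)
Section Plane.
Variable R : realType.
Implicit Types (a b c p q : R * R) (A B T : set (R * R)) (F : set (set (R * R))).

(* The library norm on R * R is the sup norm, hence this definition.  The
   topology it induces is nevertheless the library (product) topology. *)
Definition edist p q : R :=
  Num.sqrt ((p.1 - q.1) ^+ 2 + (p.2 - q.2) ^+ 2).

Definition isometry (f : R * R -> R * R) : Prop :=
  forall p q, edist (f p) (f q) = edist p q.

Definition congruent A B : Prop :=
  exists2 f : R * R -> R * R, isometry f & f @` A = B.

Definition line p v : set (R * R) := range (fun t : R => p + t *: v).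

(* The direction v may be 0: line p 0 is a single point, which still makes
   three equal points collinear and nothing else. *)
Definition collinear a b c : Prop :=
  exists p v, [/\ line p v a, line p v b & line p v c].

Definition convex_hull3 a b c : set (R * R) :=
  [set p | exists x y z : R, [/\ 0 <= x, 0 <= y, 0 <= z, x + y + z = 1 &
     p = x *: a + y *: b + z *: c]].

Definition triangle_on a b c T : Prop :=
  ~ collinear a b c /\ T = convex_hull3 a b c.

Definition is_triangle T : Prop := exists a b c, triangle_on a b c T.

(* The vertices are the extreme points of T, so l is determined by T. *)
Definition has_perimeter T (l : R) : Prop :=
  exists a b c, triangle_on a b c T /\ edist a b + edist b c + edist c a = l.

Definition area A : \bar R :=
  ((@lebesgue_measure R) \x (@lebesgue_measure R))%E A.

Definition tiling F : Prop :=
  [/\ forall T, F T -> closed T,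
      \bigcup_(T in F) T = setT
    & trivIset F (fun T => T°)].

End Plane.

(* Main.v *)
(* Let the triangle [CPA] have its side [CA] on one boundary line of a strip
   of height [h] and its vertex [P] on the other one. If [a] and [b] are the
   tangents of half the angles at [C] and at [A], then [bal a b = 0] says that
   some cevian from [A] to a point [M] of [CP] cuts the triangle into two
   triangles of unit perimeter. The next triangle of the strip has its side on
   the other boundary line and shares the side [PA], so it sees the angle at
   [A] again: a half-strip is tiled from any sequence with [bal (a n) (a n.+1)
   = 0]. For [h = 19 / 40] such a sequence can be continued forever from any
   [a 0] close to [1]: all the later terms lie in the interval [[lo, hi]],
   which does not contain [a 0], and [a n.+1] determines [a n]; hence
   sequences with different starting values have no term in common. Every
   strip is made of a half-strip of starting value [c] and of the mirror image
   of one of starting value [1 / c], with a different [c > 1] in each strip.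
   Diameters separate the triangles: that of [AMC] is [AM < h] and determines
   [a] and [b], that of [AMP] is [AP >= h] and determines [b]. *)

Require Import Defs.
From mathcomp Require Import all_boot all_order all_algebra.
From mathcomp Require Import all_classical all_reals all_analysis.
From mathcomp Require Import measurable_realfun.
From mathcomp Require Import ring lra.
Import Order.TTheory GRing.Theory Num.Theory.
Import numFieldNormedType.Exports.
Local Open Scope classical_set_scope.
Local Open Scope ring_scope.

(** * The balance equation and numerical bounds on its solutions *)

Section Balance.
Variable R : realType.
Implicit Types a b : R.

Definition hgt : R := 19 / 40.
(* [bal a] changes sign on [[lo, hi]] for every [a] in [[lo, top]], and
   [hi < top^-1]: this is what these values are chosen for. *)
Definition lo : R := 8 / 11.
Definition hi : R := 4 / 5.
Definition top : R := 81 / 80.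
Local Notation h := hgt.

(* Writing [k = 1 / (h * (1 / a + 1 / b))] and [m = a * b], [bal a b = 0] is
   [m * (1 - m) = (1 + a ^+ 2) * (k * (1 - k))]. *)
Definition bal a b : R :=
  (1 + a ^+ 2) * (a * b - h * (a + b)) + h ^+ 2 * (a + b) ^+ 2 * (1 - a * b).

(** [bal] is cubic in [a] with coefficients [c1], [c2], [c3] in degrees 1, 2, 3. With [S = a1 + a2],
    its difference quotient is [c1 + c2 * S + c3 * (3 / 4 * S ^+ 2 + (a1 - a2) ^+ 2 / 4)]. Expanded
    in [u], the distance of [S] from its maximum [2 * top], it has only nonnegative terms and a
    positive constant one. *)
Lemma ltr_bal a1 a2 b : a1 < a2 -> a2 <= top -> lo <= b <= hi ->
  bal a1 b < bal a2 b.
Proof.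
move=> a12 a2_le /andP[b_ge b_le].
pose c1 := b - h + 2 * h ^+ 2 * b - h ^+ 2 * b ^+ 3.
pose c2 := - h * b + h ^+ 2 - 2 * h ^+ 2 * b ^+ 2.
pose c3 := b - h - h ^+ 2 * b.
pose S := a1 + a2.
pose u := 2 * top - S.
have u_ge0 : 0 <= u by rewrite /u /S; clear -a12 a2_le; lra.
have c3_gt0 : 0 < c3 by rewrite /c3; clear -b_ge; move: b_ge; rewrite /hgt /lo; lra.
have h1 : 0 < c1 + c2 * (2 * top) + 3 / 4 * c3 * (2 * top) ^+ 2.
  rewrite /c1 /c2 /c3; clear -b_ge b_le; move: b_ge b_le.
  by rewrite /hgt /top /lo /hi => *; nra.
have h2 : 0 <= - (c2 + 3 / 2 * c3 * (2 * top)).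
  rewrite /c2 /c3; clear -b_ge b_le; move: b_ge b_le.
  by rewrite /hgt /top /lo /hi => *; nra.
have h3 : 0 <= c3 * (3 / 4 * u ^+ 2 + (a1 - a2) ^+ 2 / 4).
  apply: mulr_ge0; first exact: ltW.
  have := sqr_ge0 u; have := sqr_ge0 (a1 - a2); clear.
  by move: (u ^+ 2) ((a1 - a2) ^+ 2) => *; lra.
have h4 := mulr_ge0 h2 u_ge0.
rewrite -subr_gt0.
have -> : bal a2 b - bal a1 b = (a2 - a1) *
    (c1 + c2 * (2 * top) + 3 / 4 * c3 * (2 * top) ^+ 2 +
     - (c2 + 3 / 2 * c3 * (2 * top)) * u +
     c3 * (3 / 4 * u ^+ 2 + (a1 - a2) ^+ 2 / 4)).
  by rewrite /bal /c1 /c2 /c3 /u /S; field.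
apply: mulr_gt0; first by rewrite subr_gt0.
apply: ltr_wpDr; first exact: h3.
by apply: ltr_wpDr; [exact: h4|exact: h1].
Qed.

Lemma bal_inj a1 a2 b : a1 <= top -> a2 <= top -> lo <= b <= hi ->
  bal a1 b = bal a2 b -> a1 = a2.
Proof.
move=> h1 h2 hb e; case: (ltgtP a1 a2) => // a12; exfalso.
- by have := ltr_bal _ _ _ a12 h2 hb; rewrite e ltxx.
- by have := ltr_bal _ _ _ a12 h1 hb; rewrite e ltxx.
Qed.

Lemma bal_root a : lo <= a <= top -> exists2 b, lo <= b <= hi & bal a b = 0.
Proof.
move=> /andP[a_ge a_le].
pose q : {poly R} := (1 + a ^+ 2)%:P * (a%:P * 'X - h%:P * (a%:P + 'X))
  + (h ^+ 2)%:P * (a%:P + 'X) ^+ 2 * (1 - a%:P * 'X).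
have qE b : q.[b] = bal a b by rewrite /q /bal !hornerE.
have lo_hi : lo <= hi by rewrite /lo /hi; clear; lra.
(* By monotonicity in [a], the worst cases are [a = top] at [lo] and [a = lo] at [hi]. *)
have q_le0 : bal a lo <= 0.
  apply: (@le_trans _ _ (bal top lo)).
    move: a_le; rewrite le_eqVlt => /orP[/eqP -> //|a_lt].
    by apply/ltW/ltr_bal; rewrite ?lexx.
  by rewrite /bal /hgt /top /lo; clear; lra.
have q_ge0 : 0 <= bal a hi.
  apply: (@le_trans _ _ (bal lo hi)).
    by rewrite /bal /hgt /hi /lo; clear; lra.
  move: a_ge; rewrite le_eqVlt => /orP[/eqP -> //|a_gt].
  by apply/ltW/ltr_bal; rewrite ?lexx ?lo_hi.
have [|b hb rb] := @poly_ivt _ q lo hi lo_hi; first by rewrite !qE q_le0.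
by exists b => //; rewrite -qE; apply/eqP.
Qed.

(** These bound the two parts of the cofactor in [bal_sumV_inj]. The product is negative only if
    [a1 * a2 < b1 * b2], and is then at least [- (1 / 9 * (16 / 25))]. *)
Lemma bal_box a1 a2 b1 b2 : lo <= a1 <= top -> lo <= a2 <= top ->
  lo <= b1 <= hi -> lo <= b2 <= hi ->
  3 / 4 <= a1 * a2 * (a1 + a2) /\
  - (2 / 27) <= (a1 * a2 - b1 * b2) * (a1 * b1 + a2 * b2 - 1).
Proof.
move=> /andP[l1 u1] /andP[l2 u2] /andP[l3 u3] /andP[l4 u4].
have lo0 : 0 <= lo by rewrite /lo; clear; lra.
have lb (x y : R) : lo <= x -> lo <= y -> lo * lo <= x * y.
  by move=> hx hy; exact: ler_pM.
have ub (x y u : R) : lo <= x -> lo <= y -> x <= u -> y <= hi -> x * y <= u * hi.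
  by move=> hx hy xu yh; apply: ler_pM => //; apply: le_trans lo0 _.
split.
  have := lb _ _ l1 l2.
  have s_ge : lo + lo <= a1 + a2 by exact: lerD.
  move=> p_ge; have : lo * lo * (lo + lo) <= a1 * a2 * (a1 + a2).
    by apply: ler_pM => //; rewrite ?mulr_ge0 ?addr_ge0.
  by apply: le_trans; rewrite /lo; clear; lra.
have := ub _ _ _ l1 l3 u1 u3; have := ub _ _ _ l2 l4 u2 u4.
have := ub _ _ _ l3 l4 u3 u4; have := lb _ _ l1 l2.
have := lb _ _ l1 l3; have := lb _ _ l2 l4.
move: (a1 * a2) (b1 * b2) (a1 * b1) (a2 * b2).
rewrite /lo /hi /top; clear => x y z t h1 h2 h3 h4 h5 h6.
have Y0 : 0 <= z + t - 1 by clear -h1 h2; lra.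
have [xy|xy] := leP y x.
  apply: (@le_trans _ _ 0); first by clear; lra.
  by apply: mulr_ge0; first rewrite subr_ge0.
have yx0 : 0 <= y - x by clear -xy; lra.
have yx1 : y - x <= 1 / 9 by clear -h3 h4; lra.
have Y1 : z + t - 1 <= 16 / 25 by clear -h5 h6; lra.
have := ler_pM yx0 Y0 yx1 Y1.
have -> : (x - y) * (z + t - 1) = - ((y - x) * (z + t - 1)) by ring.
by move: ((y - x) * (z + t - 1)); clear => ? ?; lra.
Qed.

Lemma lo_neq0 (x : R) : lo <= x -> x != 0.
Proof. by move=> hx; rewrite gt_eqF // (lt_le_trans _ hx) // /lo; lra. Qed.

Lemma sumV_ge a b : lo <= a <= top -> lo <= b <= hi -> 80 / 81 + 5 / 4 <= a^-1 + b^-1.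
Proof.
move=> /andP[a_ge a_le] /andP[b_ge b_le].
have lo0 : 0 < lo by rewrite /lo; clear; lra.
have aV : top^-1 <= a^-1.
  by rewrite lef_pV2 ?posrE ?(lt_le_trans lo0 a_ge) ?(lt_le_trans _ a_le)
    ?(lt_le_trans lo0 a_ge).
have bV : hi^-1 <= b^-1.
  by rewrite lef_pV2 ?posrE ?(lt_le_trans lo0 b_ge) ?(lt_le_trans _ b_le)
    ?(lt_le_trans lo0 b_ge).
by rewrite -(invf_div 81 80) -(invf_div 4 5); exact: lerD.
Qed.

Lemma bal_sumV a b (T := a^-1 + b^-1) : a != 0 -> b != 0 -> bal a b = 0 ->
  (1 + a ^+ 2) * (h * T - 1) = h ^+ 2 * T ^+ 2 * (a * b) * (1 - a * b).
Proof.
move=> a0 b0; rewrite /bal.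
have -> : a + b = a * b * T by rewrite /T; field; rewrite a0 b0.
have -> : (1 + a ^+ 2) * (a * b - h * (a * b * T)) +
    h ^+ 2 * (a * b * T) ^+ 2 * (1 - a * b) =
  (a * b) * (h ^+ 2 * T ^+ 2 * (a * b) * (1 - a * b) -
             (1 + a ^+ 2) * (h * T - 1)) by ring.
by move/eqP; rewrite !mulf_eq0 (negPf a0) (negPf b0) /= subr_eq0 => /eqP ->.
Qed.

(** The length of the cevian is [1 - h / 2 * T] with [T = 1 / a + 1 / b], so this says that it
    determines [a]. Subtracting the two instances of [bal_sumV] for the same [T] leaves [a2 - a1]
    times a positive cofactor. *)
Lemma bal_sumV_inj a1 a2 b1 b2 : lo <= a1 <= top -> lo <= a2 <= top ->
  lo <= b1 <= hi -> lo <= b2 <= hi -> bal a1 b1 = 0 -> bal a2 b2 = 0 ->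
  a1^-1 + b1^-1 = a2^-1 + b2^-1 -> a1 = a2.
Proof.
move=> ha1 ha2 hb1 hb2 e1 e2 es.
have a10 : a1 != 0 by case/andP: ha1 => /lo_neq0.
have a20 : a2 != 0 by case/andP: ha2 => /lo_neq0.
have b10 : b1 != 0 by case/andP: hb1 => /lo_neq0.
have b20 : b2 != 0 by case/andP: hb2 => /lo_neq0.
have k1 := bal_sumV _ _ a10 b10 e1; have k2 := bal_sumV _ _ a20 b20 e2.
rewrite -es in k2; pose T := a1^-1 + b1^-1; rewrite -/T in k1 k2.
have /eqP : (a2 - a1) * (a1 * a2 * (a1 + a2) * (h * T - 1)
    + h * (h * T) * ((a1 * a2 - b1 * b2) * (a1 * b1 + a2 * b2 - 1))) = 0.
  (* Equal sums make [t] also equal to [b2^-1 - b1^-1]; all differences become multiples of [t]. *)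
  pose t := a1^-1 - a2^-1.
  have t1 : a2 - a1 = t * (a1 * a2) by rewrite /t; field; rewrite a10 a20.
  have t2 : b2 - b1 = - t * (b1 * b2).
    have -> : t = b2^-1 - b1^-1 by rewrite /t; clear -es; lra.
    by field; rewrite b10 b20.
  have m1 : a1 + b1 = a1 * b1 * T by rewrite /T; field; rewrite a10 b10.
  have m2 : a2 + b2 = a2 * b2 * T by rewrite /T es; field; rewrite a20 b20.
  have d : T * (a2 * b2 - a1 * b1) = t * (a1 * a2 - b1 * b2).
    transitivity ((a2 + b2) - (a1 + b1)); first by rewrite m1 m2; ring.
    transitivity ((a2 - a1) + (b2 - b1)); first by ring.
    by rewrite t1 t2; ring.
  transitivity ((a1 * a2) * ((1 + a2 ^+ 2) * (h * T - 1) - (1 + a1 ^+ 2) * (h * T - 1))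
     + (a2 - a1) * (h * (h * T) * ((a1 * a2 - b1 * b2) * (a1 * b1 + a2 * b2 - 1)))).
    by ring.
  rewrite k1 k2 t1.
  transitivity ((a1 * a2) * (h ^+ 2 * T) * (a1 * b1 + a2 * b2 - 1)
    * (t * (a1 * a2 - b1 * b2) - T * (a2 * b2 - a1 * b1))); first by ring.
  by rewrite d subrr mulr0.
rewrite mulf_eq0 subr_eq0 => /orP[/eqP -> //|/eqP F]; exfalso.
have T_ge : 80 / 81 + 5 / 4 <= T := sumV_ge _ _ ha1 hb1.
have [A_ge Z_ge] := bal_box _ _ _ _ ha1 ha2 hb1 hb2.
have u_ge : 0 <= h * T - 1 by clear -T_ge; rewrite /hgt; lra.
have hT_ge : 0 <= h * (h * T) by clear -T_ge; rewrite /hgt; lra.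
have P1 := ler_wpM2r u_ge A_ge; have P2 := ler_wpM2l hT_ge Z_ge.
move: P1 P2 F.
move: (a1 * a2 * (a1 + a2) * (h * T - 1)) (h * (h * T) * ((_ - _) * _)) => x y.
by rewrite /hgt; clear -T_ge => *; lra.
Qed.

Lemma box_invr a : lo <= a -> a^-1 <= 11 / 8.
Proof.
move=> a_ge; have lo0 : 0 < lo by rewrite /lo; clear; lra.
by rewrite -(invf_div 8 11) lef_pV2 ?posrE // (lt_le_trans lo0).
Qed.

Lemma box_mul a b : lo <= a <= top -> lo <= b <= hi -> 1 / 2 <= a * b <= 81 / 100.
Proof.
move=> /andP[a_ge a_le] /andP[b_ge b_le].
have lo0 : 0 <= lo by rewrite /lo; clear; lra.
have := ler_pM lo0 lo0 a_ge b_ge.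
have := ler_pM (le_trans lo0 a_ge) (le_trans lo0 b_ge) a_le b_le.
by rewrite /lo /top /hi; clear => *; apply/andP; split; lra.
Qed.

(** This is the length of [CA]. The bound keeps the areas away from 0 and makes the triangles
    exhaust the half-strip. *)
Lemma box_base a b : lo <= a <= top -> lo <= b <= hi ->
  1 / 12 <= h / 2 * (a^-1 + b^-1) * (1 - a * b).
Proof.
move=> ha hb; have T_ge := sumV_ge _ _ ha hb; have /andP[_ m_le] := box_mul _ _ ha hb.
have T0 : 0 <= h / 2 * (80 / 81 + 5 / 4) by rewrite /hgt; clear; lra.
have m0 : (0 : R) <= 19 / 100 by clear; lra.
have l1 : h / 2 * (80 / 81 + 5 / 4) <= h / 2 * (a^-1 + b^-1).
  by apply: ler_wpM2l T_ge; rewrite /hgt; clear; lra.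
have l2 : 19 / 100 <= 1 - a * b by clear -m_le; lra.
apply: le_trans (ler_pM T0 m0 l1 l2); rewrite /hgt; clear; lra.
Qed.

(** The ratio of [CM] to [CP]: neither part of the triangle degenerates. *)
Lemma box_cut a b : lo <= a <= top -> lo <= b <= hi ->
  1 / 2 <= a * (a + b) / (1 + a ^+ 2) <= 11 / 12.
Proof.
move=> ha hb; have /andP[m_ge m_le] := box_mul _ _ ha hb.
case/andP: ha => a_ge a_le.
have lo0 : 0 <= lo by rewrite /lo; clear; lra.
have := ler_pM lo0 lo0 a_ge a_ge.
have := ler_pM (le_trans lo0 a_ge) (le_trans lo0 a_ge) a_le a_le.
rewrite mulrDr expr2; move: (a * a) (a * b) m_ge m_le => x y; rewrite /lo /top.
clear => y_ge y_le x_le x_ge; have x1 : 0 < 1 + x by clear -x_ge; lra.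
by apply/andP; split; [rewrite ler_pdivlMr //|rewrite ler_pdivrMr //]; lra.
Qed.

(** With [box_cevian_ge]: [AM] is at least as long as [CA] and [CM], hence the diameter of [AMC]. *)
Lemma box_cevian_gt a b : lo <= a <= top -> lo <= b <= hi ->
  h / 2 * (a^-1 + b^-1) * (1 - a * b) <= 1 - h / 2 * (a^-1 + b^-1).
Proof.
move=> /andP[a_ge _] /andP[b_ge _]; have := box_invr _ a_ge; have := box_invr _ b_ge.
have -> : h / 2 * (a^-1 + b^-1) * (1 - a * b) =
    h / 2 * (a^-1 + b^-1) - h / 2 * (a + b).
  by field; rewrite !lo_neq0.
by move: (a^-1) (b^-1) a_ge b_ge; rewrite /lo /hgt; clear => *; lra.
Qed.

(** The maximum is at [a = lo], because [top] is below [lo^-1 = 11 / 8]. *)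
Lemma box_addV a : lo <= a <= top -> a + a^-1 <= 8 / 11 + 11 / 8.
Proof.
move=> /andP[a_ge a_le]; have aV := box_invr _ a_ge; have a0 := lo_neq0 _ a_ge.
rewrite -subr_ge0.
have -> : 8 / 11 + 11 / 8 - (a + a^-1) = (a - 8 / 11) * (11 / 8 - a) / a by field.
have lo0 : 0 < lo by rewrite /lo; clear; lra.
apply: divr_ge0; last by rewrite ltW // (lt_le_trans lo0).
by apply: mulr_ge0; move: a_ge a_le; rewrite /lo /top; clear; lra.
Qed.

Lemma box_cevian_ge a b : lo <= a <= top -> lo <= b <= hi ->
  h / 2 * (a + b) <= 1 - h / 2 * (a^-1 + b^-1).
Proof.
move=> ha /andP[b_ge b_le]; have := box_addV _ ha.
have hb : lo <= b <= top by rewrite b_ge (le_trans b_le) // /hi /top; lra.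
have := box_addV _ hb.
by move: (a^-1) (b^-1); rewrite /hgt; clear => *; lra.
Qed.

Lemma box_cevian_lt a b : lo <= a <= top -> lo <= b <= hi ->
  1 - h / 2 * (a^-1 + b^-1) < h.
Proof.
by move=> ha hb; have := sumV_ge _ _ ha hb; rewrite /hgt; clear; lra.
Qed.

(** The right side is the length of [PA], which crosses the strip. [box_stub_le] is about [MP]. *)
Lemma box_leg_ge b : lo <= b -> h <= h / 2 * (b + b^-1).
Proof.
move=> b_ge; have lo0 : 0 < lo by rewrite /lo; clear; lra.
have b0 := lt_le_trans lo0 b_ge.
have e : b + b^-1 - 2 = (b - 1) ^+ 2 / b by field; exact: lo_neq0.
have : 0 <= b + b^-1 - 2 by rewrite e divr_ge0 ?sqr_ge0 // ltW.
by rewrite /hgt; move: (b^-1); clear => *; lra.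
Qed.

Lemma box_stub_le a b : lo <= a <= top -> lo <= b <= hi ->
  h / 2 * (a^-1 - b) <= h.
Proof.
move=> /andP[a_ge _] /andP[b_ge _]; have := box_invr _ a_ge.
by move: (a^-1) b_ge; rewrite /hgt /lo; clear => *; lra.
Qed.

(* Stewart's theorem for the cevian, whose length is [1 - h / 2 * (1 / a + 1 / b)]
   exactly when [bal a b = 0]. *)
Lemma bal_stewart a b (t := a * (a + b) / (1 + a ^+ 2)) : a != 0 -> b != 0 ->
  (t * (h / 2 * (a^-1 - a)) - (h / 2 * (a^-1 - a) + h / 2 * (b^-1 - b))) ^+ 2
    + (h * t) ^+ 2 =
  (1 - h / 2 * (a^-1 + b^-1)) ^+ 2 - bal a b / (a * b * (1 + a ^+ 2)).
Proof.
move=> a0 b0; have a21 : 1 + a ^+ 2 != 0 by rewrite gt_eqF // ltr_pwDl // sqr_ge0.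
by rewrite /t /bal; field; rewrite a0 b0 a21.
Qed.

End Balance.

(** * Distances, diameters and barycentric coordinates in the plane *)

Section Plane.
Local Notation edist := Defs.edist.
Variable R : realType.
Implicit Types (a b c p q : R * R) (T : set (R * R)).

Lemma edistE p q (r : R) : 0 <= r ->
  (p.1 - q.1) ^+ 2 + (p.2 - q.2) ^+ 2 = r ^+ 2 -> edist p q = r.
Proof. by move=> r0 e; rewrite /edist e sqrtr_sqr ger0_norm. Qed.

Lemma edist_le p q (r : R) : 0 <= r ->
  (edist p q <= r) = ((p.1 - q.1) ^+ 2 + (p.2 - q.2) ^+ 2 <= r ^+ 2).
Proof.
move=> r0; rewrite -{1}[r](ger0_norm r0) -sqrtr_sqr /edist ler_sqrt //.
exact: sqr_ge0.
Qed.

Lemma edistC p q : edist p q = edist q p.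
Proof. by rewrite /edist -(sqrrN (p.1 - q.1)) -(sqrrN (p.2 - q.2)) !opprB. Qed.

Lemma edistxx p : edist p p = 0.
Proof. by rewrite /edist !subrr expr0n addr0 sqrtr0. Qed.

Lemma hull3P a b c p : convex_hull3 a b c p <->
  exists x y z : R, [/\ 0 <= x, 0 <= y, 0 <= z, x + y + z = 1 &
    p.1 = x * a.1 + y * b.1 + z * c.1 /\ p.2 = x * a.2 + y * b.2 + z * c.2].
Proof.
split=> -[x [y [z [x0 y0 z0 e]]]].
  by move=> ->; exists x, y, z.
by case: p => p1 p2 /= [-> ->]; exists x, y, z.
Qed.

Lemma hull3_vertex1 a b c : convex_hull3 a b c a.
Proof. by apply/hull3P; exists 1, 0, 0; split; rewrite ?ler01 //; [ring|split; ring]. Qed.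

Lemma hull3_vertex2 a b c : convex_hull3 a b c b.
Proof. by apply/hull3P; exists 0, 1, 0; split; rewrite ?ler01 //; [ring|split; ring]. Qed.

Lemma hull3_edist_le a b c p q (r : R) : 0 <= r -> convex_hull3 a b c p ->
  edist a q <= r -> edist b q <= r -> edist c q <= r -> edist p q <= r.
Proof.
move=> r0 /hull3P[x [y [z [x0 y0 z0 e [e1 e2]]]]]; rewrite !edist_le // => ha hb hc.
have jensen (u v w s : R) : s = x * u + y * v + z * w -> forall t,
    (s - t) ^+ 2 <= x * (u - t) ^+ 2 + y * (v - t) ^+ 2 + z * (w - t) ^+ 2.
  move=> -> t; rewrite -subr_ge0.
  (* The variance of three weighted points, as a sum over pairs. *)
  have -> : x * (u - t) ^+ 2 + y * (v - t) ^+ 2 + z * (w - t) ^+ 2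
      - (x * u + y * v + z * w - t) ^+ 2 =
    x * y * (u - v) ^+ 2 + y * z * (v - w) ^+ 2 + x * z * (u - w) ^+ 2.
    have -> : x = 1 - y - z by lra.
    ring.
  by rewrite !addr_ge0 // mulr_ge0 ?sqr_ge0 // mulr_ge0.
have := jensen _ _ _ _ e1 q.1; have := jensen _ _ _ _ e2 q.2.
have : x * ((a.1 - q.1) ^+ 2 + (a.2 - q.2) ^+ 2) <= x * r ^+ 2 by rewrite ler_wpM2l.
have : y * ((b.1 - q.1) ^+ 2 + (b.2 - q.2) ^+ 2) <= y * r ^+ 2 by rewrite ler_wpM2l.
have : z * ((c.1 - q.1) ^+ 2 + (c.2 - q.2) ^+ 2) <= z * r ^+ 2 by rewrite ler_wpM2l.
have : x * r ^+ 2 + y * r ^+ 2 + z * r ^+ 2 = r ^+ 2 by rewrite -!mulrDl e mul1r.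
lra.
Qed.

Definition has_diameter T (d : R) : Prop :=
  (exists p q, [/\ T p, T q & edist p q = d]) /\
  forall p q, T p -> T q -> edist p q <= d.

(** Distance is convex in each argument, so moving one end after the other to a vertex bounds it by
    the longest side. *)
Lemma hull3_diameter a b c : edist b c <= edist a b -> edist c a <= edist a b ->
  has_diameter (convex_hull3 a b c) (edist a b).
Proof.
move=> bc ca; split.
  by exists a, b; split=> //; [exact: hull3_vertex1|exact: hull3_vertex2].
move=> p q Tp Tq; have r0 : 0 <= edist a b by rewrite sqrtr_ge0.
by apply: (hull3_edist_le _ _ _ _ _ _ r0 Tp); rewrite edistC;
  apply: (hull3_edist_le _ _ _ _ _ _ r0 Tq); rewrite ?edistxx // edistC.
Qed.

Lemma congruent_diameter T T' (d d' : R) : congruent T T' ->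
  has_diameter T d -> has_diameter T' d' -> d = d'.
Proof.
move=> [f fi <-] [[p [q [Tp Tq dE]]] Td] [[_ [_ [[p' Tp' <-] [q' Tq' <-] dE']]] Td'].
apply/eqP; rewrite eq_le; apply/andP; split.
  by rewrite -dE -fi Td'.
by rewrite -dE' fi Td.
Qed.

(** Twice the signed area of the triangle. *)
Definition cross a b c : R :=
  (b.1 - a.1) * (c.2 - a.2) - (b.2 - a.2) * (c.1 - a.1).

Lemma collinear_cross a b c : collinear a b c -> cross a b c = 0.
Proof.
by move=> [p [v [[x _ <-] [y _ <-] [z _ <-]]]]; rewrite /cross /= /GRing.scale /=; ring.
Qed.

(** Cramer's rule: the quotients are the barycentric coordinates of [p]. *)
Lemma hull3E a b c : cross a b c != 0 ->
  convex_hull3 a b c = [set p | [/\ 0 <= cross p b c / cross a b c,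
    0 <= cross a p c / cross a b c & 0 <= cross a b p / cross a b c]].
Proof.
move=> d0; apply/seteqP; split=> p /=.
  move=> /hull3P[x [y [z [x0 y0 z0 e [e1 e2]]]]].
  have xE : x = 1 - y - z by lra.
  have -> : cross p b c = x * cross a b c.
    by rewrite /cross e1 e2 xE; ring.
  have -> : cross a p c = y * cross a b c.
    by rewrite /cross e1 e2 xE; ring.
  have -> : cross a b p = z * cross a b c.
    by rewrite /cross e1 e2 xE; ring.
  by rewrite !mulfK.
move=> [x0 y0 z0]; apply/hull3P; do 3 eexists; split; [exact: x0|exact: y0|exact: z0| |].
  rewrite -!mulrDl; apply: (canLR (mulfK d0)); rewrite /cross; ring.
by split; rewrite !(mulrAC _ (cross a b c)^-1) -!mulrDl; apply: (canRL (mulfK d0));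
  rewrite /cross; ring.
Qed.

End Plane.

(** * Closedness, measurability, area bound and separation by lines *)

Section Area.
Variable R : realType.
Local Notation edist := Defs.edist.
Implicit Types (a b c p q : R * R) (A B : set (R * R)).

Definition halfplane (u v w : R) : set (R * R) :=
  [set p | 0 <= u * p.1 + v * p.2 + w].

Lemma closed_halfplane u v w : closed (halfplane u v w).
Proof.
have cont : continuous (fun p : R * R => u * p.1 + v * p.2 + w).
  move=> p; apply: cvgD; last exact: cvg_cst.
  by apply: cvgD; apply: cvgM; try exact: cvg_cst; [exact: cvg_fst|exact: cvg_snd].
apply: (@preimage_closed _ _ (fun p : R * R => u * p.1 + v * p.2 + w)
  [set x : R | 0 <= x]).
  by move=> p _; exact: cont.
exact: closed_ge.
Qed.

Lemma measurable_halfplane u v w : measurable (halfplane u v w).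
Proof.
have mf : measurable_fun setT (fun p : R * R => u * p.1 + v * p.2 + w).
  apply: measurable_funD; last exact: measurable_cst.
  by apply: measurable_funD; apply: measurable_funM => //; exact: measurable_cst.
rewrite (_ : halfplane u v w =
  setT `&` (fun p : R * R => u * p.1 + v * p.2 + w) @^-1` `[0, +oo[).
  by apply: mf => //; exact: measurable_itv.
by rewrite setTI; apply/seteqP; split=> p /=; rewrite in_itv /= andbT.
Qed.

Lemma hull3_halfplanes a b c : cross _ a b c != 0 ->
  exists u v w (u' v' w' u'' v'' w'' : R), convex_hull3 a b c =
    halfplane u v w `&` halfplane u' v' w' `&` halfplane u'' v'' w''.
Proof.
move=> d0; pose d := cross _ a b c.
exists ((b.2 - c.2) / d), ((c.1 - b.1) / d), (cross _ (0, 0) b c / d).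
exists ((c.2 - a.2) / d), ((a.1 - c.1) / d), (cross _ a (0, 0) c / d).
exists ((a.2 - b.2) / d), ((b.1 - a.1) / d), (cross _ a b (0, 0) / d).
rewrite hull3E //; apply/seteqP; rewrite /halfplane -/d.
have e1 p : cross _ p b c / d =
    (b.2 - c.2) / d * p.1 + (c.1 - b.1) / d * p.2 + cross _ (0, 0) b c / d.
  by rewrite /cross /=; ring.
have e2 p : cross _ a p c / d =
    (c.2 - a.2) / d * p.1 + (a.1 - c.1) / d * p.2 + cross _ a (0, 0) c / d.
  by rewrite /cross /=; ring.
have e3 p : cross _ a b p / d =
    (a.2 - b.2) / d * p.1 + (b.1 - a.1) / d * p.2 + cross _ a b (0, 0) / d.
  by rewrite /cross /=; ring.
by split=> p /=; rewrite -e1 -e2 -e3; [case|do 2 case].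
Qed.

Lemma closed_hull3 a b c : cross _ a b c != 0 -> closed (convex_hull3 a b c).
Proof.
move=> /hull3_halfplanes[? [? [? [? [? [? [? [? [? ->]]]]]]]]].
by do 2?apply: closedI; exact: closed_halfplane.
Qed.

Lemma measurable_hull3 a b c : cross _ a b c != 0 -> measurable (convex_hull3 a b c).
Proof.
move=> /hull3_halfplanes[? [? [? [? [? [? [? [? [? ->]]]]]]]]].
by do 2?apply: measurableI; exact: measurable_halfplane.
Qed.

Lemma edist_ge p q : `|p.1 - q.1| <= edist p q /\ `|p.2 - q.2| <= edist p q.
Proof.
by split; rewrite -sqrtr_sqr /Defs.edist ler_wsqrtr // ?lerDl ?lerDr sqr_ge0.
Qed.

Lemma area_square (x y r : R) : 0 <= r ->
  area (`[x - r, x + r]%classic `*` `[y - r, y + r]%classic) = ((2 * r) ^+ 2)%:E.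
Proof.
move=> r0; rewrite /area product_measure1E; [|exact: measurable_itv|exact: measurable_itv].
have E z : lebesgue_measure `[z - r, z + r]%classic = (2 * r)%:E.
  rewrite lebesgue_measure_itv /= lte_fin; case: ltP => [_|h].
    by rewrite -EFinB; congr EFin; ring.
  by congr EFin; lra.
by rewrite expr2 EFinM; congr (_ * _)%E; exact: E.
Qed.

(* The square of half side [d / 6] around the centroid fits in the triangle. *)
Lemma area_hull3_ge a b c (d : R) : 0 < d -> d <= `|cross _ a b c| ->
  edist a b + edist b c + edist c a = 1 ->
  (((d / 3) ^+ 2)%:E <= area (convex_hull3 a b c))%E.
Proof.
move=> d0 dle per.
pose D := cross _ a b c.
have D0 : D != 0 by rewrite -normr_gt0 (lt_le_trans d0).
pose r := d / 6.
pose x := (a.1 + b.1 + c.1) / 3; pose y := (a.2 + b.2 + c.2) / 3.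
have r0 : 0 <= r by rewrite /r; clear -d0; lra.
have -> : d / 3 = 2 * r by rewrite /r; field.
rewrite -(area_square x y r) //; apply: le_measure.
- by rewrite inE; apply: measurableX; exact: measurable_itv.
- by rewrite inE; exact: measurable_hull3.
(* Each barycentric coordinate is [1 / 3] at the centroid. Here [e1], [e2] are the displacement from
   it and [k], [l] the coordinates of a side, at most 1 since the perimeter is 1; the change is at
   most [2 * r / |D| <= 1 / 3]. *)
have dev e1 e2 (k l : R) : `|e1| <= r -> `|e2| <= r -> `|k| <= 1 -> `|l| <= 1 ->
    0 <= (D / 3 + (e1 * k + e2 * l)) / D.
  move=> h1 h2 h3 h4.
  have h5 : `|e1 * k + e2 * l| <= `|D| / 3.
    apply: (le_trans (ler_normD _ _)); rewrite !normrM.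
    have := ler_pM (normr_ge0 _) (normr_ge0 _) h1 h3.
    have := ler_pM (normr_ge0 _) (normr_ge0 _) h2 h4.
    by move: dle; rewrite /r -/D; clear; lra.
  have -> : (D / 3 + (e1 * k + e2 * l)) / D = 1 / 3 + (e1 * k + e2 * l) / D by field.
  have : `|(e1 * k + e2 * l) / D| <= 1 / 3.
    rewrite normrM normfV ler_pdivrMr ?normr_gt0 //.
    by move: h5; clear; lra.
  by rewrite ler_norml => /andP[]; clear; lra.
have [ab1 ab2] := edist_ge a b; have [bc1 bc2] := edist_ge b c.
have [ca1 ca2] := edist_ge c a.
have nn p q : 0 <= edist p q by rewrite sqrtr_ge0.
have := nn a b; have := nn b c; have := nn c a => n1 n2 n3.
have l1 : edist a b <= 1 by clear -per n1 n2 n3; lra.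
have l2 : edist b c <= 1 by clear -per n1 n2 n3; lra.
have l3 : edist c a <= 1 by clear -per n1 n2 n3; lra.
move=> p [/=]; rewrite !in_itv /= => /andP[px1 px2] /andP[py1 py2].
have hx : `|p.1 - x| <= r by rewrite ler_norml; clear -px1 px2; lra.
have hy : `|p.2 - y| <= r by rewrite ler_norml; clear -py1 py2; lra.
rewrite hull3E //=; split.
- have -> : cross _ p b c = D / 3 + ((p.1 - x) * (b.2 - c.2) + (p.2 - y) * (c.1 - b.1)).
    by rewrite /D /cross /x /y; field.
  by apply: dev => //; [exact: le_trans bc2 _|rewrite distrC; exact: le_trans bc1 _].
- have -> : cross _ a p c = D / 3 + ((p.1 - x) * (c.2 - a.2) + (p.2 - y) * (a.1 - c.1)).
    by rewrite /D /cross /x /y; field.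
  by apply: dev => //; [exact: le_trans ca2 _|rewrite distrC; exact: le_trans ca1 _].
- have -> : cross _ a b p = D / 3 + ((p.1 - x) * (a.2 - b.2) + (p.2 - y) * (b.1 - a.1)).
    by rewrite /D /cross /x /y; field.
  by apply: dev => //; [exact: le_trans ab2 _|rewrite distrC; exact: le_trans ab1 _].
Qed.

Lemma hull3_affine_ge0 a b c (u v w : R) (g := fun p : R * R => u * p.1 + v * p.2 + w) p :
  convex_hull3 a b c p -> 0 <= g a -> 0 <= g b -> 0 <= g c -> 0 <= g p.
Proof.
move=> /hull3P[x [y [z [x0 y0 z0 e [e1 e2]]]]] ha hb hc.
have -> : g p = x * g a + y * g b + z * g c.
  by rewrite /g e1 e2 -[w in LHS]mul1r -e; ring.
by rewrite !addr_ge0 // mulr_ge0.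
Qed.

(** From a common interior point, small steps along [(u, v)] and against it stay in both sets, yet
    the affine function strictly increases along [(u, v)]. *)
Lemma interior_sep A B (u v w : R) : (u, v) != (0, 0) ->
  (forall p, A p -> 0 <= u * p.1 + v * p.2 + w) ->
  (forall p, B p -> u * p.1 + v * p.2 + w <= 0) -> A° `&` B° = set0.
Proof.
move=> uv hA hB; apply/seteqP; split=> // p [Ap Bp].
have : nbhs p (A `&` B) by apply: filterI.
move=> /nbhs_ballP[e /= e0 sub].
pose n := u ^+ 2 + v ^+ 2.
pose m := 1 + `|u| + `|v|.
have m0 : 0 < m by rewrite /m -addrA ltr_pwDl // addr_ge0.
have n0 : 0 < n.
  rewrite lt_neqAle addr_ge0 ?sqr_ge0 // andbT eq_sym paddr_eq0 ?sqr_ge0 //.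
  by rewrite !sqrf_eq0; apply: contra uv => /andP[/eqP -> /eqP ->].
pose t := e / 2 / m.
have t0 : 0 < t by rewrite /t !divr_gt0.
have small k : `|k| <= m -> `|t * k| < e.
  move=> km; rewrite normrM (gtr0_norm t0).
  apply: (@le_lt_trans _ _ (t * m)); first by rewrite ler_wpM2l // ltW.
  by rewrite /t mulfVK ?gt_eqF //; clear -e0; lra.
have inb : ball p e (p.1 + t * u, p.2 + t * v).
  split; rewrite /ball /= /ball_ /= opprD addrA subrr sub0r normrN; apply: small;
    rewrite /m; have := normr_ge0 u; have := normr_ge0 v; clear; lra.
have inb' : ball p e (p.1 - t * u, p.2 - t * v).
  split; rewrite /ball /= /ball_ /= opprB addrC subrK; apply: small;
    rewrite /m; have := normr_ge0 u; have := normr_ge0 v; clear; lra.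
have [_ /hB] := sub _ inb; have [/hA h2 _] := sub _ inb' => h1.
have tn : 0 < t * n by rewrite mulr_gt0.
by move: h1 h2 tn; rewrite /n /=; clear; lra.
Qed.

End Area.

(** * The tiling of one half-strip *)

Section HalfStrip.
Variable R : realType.
Local Notation edist := Defs.edist.
Local Notation h := (hgt R).
Variables (a : nat -> R) (s y0 : R).
Hypothesis s1 : s ^+ 2 = 1.
Hypothesis a_range : forall n, lo R <= a n <= top R.
Hypothesis a_tail : forall n, lo R <= a n.+1 <= hi R.
Hypothesis a_bal : forall n, bal R (a n) (a n.+1) = 0.

(* The half-strip with [y0 <= y <= y0 + h], on the right or left of the line through
   [zigzag 0] and [zigzag 1] according to the sign of [s = 1, -1]. The points
   [zigzag n], [zigzag n.+1], [zigzag n.+2] and [foot n] are [C], [P], [A] and [M]. *)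
Definition off n : R := h / 2 * ((a n)^-1 - a n).
Definition abscissa n : R := \sum_(i < n) off i.
Definition par n : R := (odd n)%:R.
Definition zigzag n : R * R := (s * abscissa n, h * par n + y0).
(** The ratio of [CM] to [CP] for which [AMC] and [AMP] have equal perimeters. *)
Definition cut n : R := a n * (a n + a n.+1) / (1 + a n ^+ 2).
Definition foot n : R * R :=
  (s * (abscissa n + cut n * off n), h * (par n + cut n * (1 - 2 * par n)) + y0).
(** [AMC] for [true], [AMP] for [false]; the first two vertices span the longest side, as
    [hull3_diameter] expects. *)
Definition tile n (ty : bool) : set (R * R) :=
  if ty then convex_hull3 (foot n) (zigzag n.+2) (zigzag n)
  else convex_hull3 (zigzag n.+1) (zigzag n.+2) (foot n).
Definition base n : R := off n + off n.+1.

Lemma abscissaS n : abscissa n.+1 = abscissa n + off n.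
Proof. by rewrite /abscissa big_ord_recr. Qed.

Lemma parS n : par n.+1 = 1 - par n.
Proof. by rewrite /par /=; case: (odd n) => /=; lra. Qed.

Lemma par_cases n : par n = 0 \/ par n = 1.
Proof. by rewrite /par; case: (odd n); [right|left]. Qed.

Lemma a_neq0 n : a n != 0.
Proof. by case/andP: (a_range n) => /lo_neq0. Qed.

Lemma den_neq0 n : 1 + a n ^+ 2 != 0.
Proof. by rewrite gt_eqF // ltr_pwDl // sqr_ge0. Qed.

Lemma baseE n : base n = h / 2 * ((a n)^-1 + (a n.+1)^-1) * (1 - a n * a n.+1).
Proof. by rewrite /base /off; field; rewrite !a_neq0. Qed.

Lemma base_ge n : 1 / 12 <= base n.
Proof. by rewrite baseE; exact: box_base. Qed.

Lemma cut_bounds n : 1 / 2 <= cut n <= 11 / 12.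
Proof. exact: box_cut. Qed.

Lemma edist_strip p q (e dx dy r : R) : e ^+ 2 = 1 -> 0 <= r ->
  p.1 - q.1 = s * dx -> p.2 - q.2 = e * dy -> dx ^+ 2 + dy ^+ 2 = r ^+ 2 ->
  edist p q = r.
Proof. by move=> e1 r0 ex ey e2; apply: edistE => //; rewrite ex ey !exprMn s1 e1 !mul1r. Qed.

Let sgn n : (1 - 2 * par n) ^+ 2 = 1.
Proof. by case: (par_cases n) => ->; ring. Qed.

Definition cevian n : R := 1 - h / 2 * ((a n)^-1 + (a n.+1)^-1).

Let h0 : 0 <= h / 2.
Proof. by rewrite /hgt; lra. Qed.

Let a_ge0 n : 0 <= a n.
Proof.
by case/andP: (a_range n) => a_ge _; apply: le_trans a_ge; rewrite /lo; lra.
Qed.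

Lemma edist_base n : edist (zigzag n.+2) (zigzag n) = base n.
Proof.
have b_ge := base_ge n.
apply: (edist_strip _ _ 1 (base n) 0); rewrite ?expr1n //.
- by lra.
- by rewrite /zigzag /= !abscissaS /base; ring.
- by rewrite /zigzag /= !parS; ring.
- by rewrite expr0n addr0.
Qed.

Lemma edist_leg n : edist (zigzag n.+1) (zigzag n.+2) = h / 2 * (a n.+1 + (a n.+1)^-1).
Proof.
apply: (edist_strip _ _ (1 - 2 * par n) (- off n.+1) h).
- exact: sgn.
- by rewrite mulr_ge0 // addr_ge0 // invr_ge0.
- by rewrite /zigzag /= !abscissaS; ring.
- by rewrite /zigzag /= !parS; ring.
- by rewrite /off; field; exact: a_neq0.
Qed.

Lemma edist_foot0 n : edist (zigzag n) (foot n) = h / 2 * (a n + a n.+1).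
Proof.
apply: (edist_strip _ _ (1 - 2 * par n) (- (cut n * off n)) (- (h * cut n))).
- exact: sgn.
- by rewrite mulr_ge0 // addr_ge0.
- by rewrite /zigzag /foot /=; ring.
- by rewrite /zigzag /foot /=; ring.
- by rewrite /off /cut; field; rewrite a_neq0 den_neq0.
Qed.

Lemma edist_foot1 n : edist (foot n) (zigzag n.+1) = h / 2 * ((a n)^-1 - a n.+1).
Proof.
apply: (edist_strip _ _ (1 - 2 * par n) (- ((1 - cut n) * off n)) (- (h * (1 - cut n)))).
- exact: sgn.
- have /andP[_ m_le] := box_mul _ _ _ (a_range n) (a_tail n).
  have -> : (a n)^-1 - a n.+1 = (1 - a n * a n.+1) / a n by field; exact: a_neq0.
  by rewrite mulr_ge0 // divr_ge0 //; lra.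
- by rewrite /zigzag /foot /= abscissaS; ring.
- by rewrite /zigzag /foot /= parS; ring.
- by rewrite /off /cut; field; rewrite a_neq0 den_neq0.
Qed.

Lemma edist_cevian n : edist (foot n) (zigzag n.+2) = cevian n.
Proof.
apply: (edist_strip _ _ (1 - 2 * par n) (cut n * off n - base n) (h * cut n)).
- exact: sgn.
- apply: le_trans (box_cevian_ge _ _ _ (a_range n) (a_tail n)).
  by rewrite mulr_ge0 // addr_ge0.
- by rewrite /zigzag /foot /= !abscissaS /base; ring.
- by rewrite /zigzag /foot /= !parS; ring.
- by rewrite /off /base /cut /off bal_stewart ?a_neq0 // a_bal mul0r subr0.
Qed.

Lemma cross_near n : cross R (foot n) (zigzag n.+2) (zigzag n) =
  - (s * (1 - 2 * par n)) * (h * (cut n * base n)).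
Proof. by rewrite /cross /zigzag /foot /= !abscissaS !parS /base; ring. Qed.

Lemma cross_far n : cross R (zigzag n.+1) (zigzag n.+2) (foot n) =
  - (s * (1 - 2 * par n)) * (h * ((1 - cut n) * base n)).
Proof. by rewrite /cross /zigzag /foot /= !abscissaS !parS /base; ring. Qed.

(** Used with [k] equal to [cut n] and [1 - cut n]; [h / 12 ^+ 2 = 19 / 5760] exceeds [1 / 320]. *)
Lemma cross_ge n (k : R) : 1 / 12 <= k ->
  1 / 320 <= `| - (s * (1 - 2 * par n)) * (h * (k * base n))|.
Proof.
move=> k_ge; have b_ge := base_ge n.
have -> : `| - (s * (1 - 2 * par n)) * (h * (k * base n))| = `|h * (k * base n)|.
  rewrite normrM normrN (_ : `|s * _| = 1) ?mul1r //.
  by apply/eqP; rewrite -sqr_norm_eq1 // exprMn s1 sgn mul1r.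
have p0 : (0 : R) <= 1 / 12 by lra.
apply: le_trans (ler_norm _); have := ler_pM p0 p0 k_ge b_ge.
by move: (k * base n); rewrite /hgt; move=> *; lra.
Qed.

(** In both tiles the two sides other than the cevian add up to [h / 2 * ((a n)^-1 + (a n.+1)^-1)],
    which is [1 - cevian n]. *)
Lemma tile_triangle n ty : exists p q r, [/\ tile n ty = convex_hull3 p q r,
  1 / 320 <= `|cross R p q r| & edist p q + edist q r + edist r p = 1].
Proof.
have /andP[c_ge c_le] := cut_bounds n.
case: ty; rewrite /tile.
  exists (foot n), (zigzag n.+2), (zigzag n); split=> //.
    by rewrite cross_near cross_ge //; lra.
  rewrite edist_cevian edist_base edist_foot0 baseE /cevian.
  by field; rewrite !a_neq0.
exists (zigzag n.+1), (zigzag n.+2), (foot n); split=> //.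
  by rewrite cross_far cross_ge //; lra.
rewrite edist_leg (edistC _ (zigzag n.+2)) edist_cevian edist_foot1 /cevian.
by field; rewrite !a_neq0.
Qed.

Definition tile_diam n (ty : bool) : R :=
  if ty then cevian n else h / 2 * (a n.+1 + (a n.+1)^-1).

Lemma tile_diameter n ty : has_diameter R (tile n ty) (tile_diam n ty).
Proof.
have cevian_lt := box_cevian_lt _ _ _ (a_range n) (a_tail n).
have leg_ge : h <= h / 2 * (a n.+1 + (a n.+1)^-1).
  by apply: box_leg_ge; case/andP: (a_tail n).
case: ty; rewrite /tile /tile_diam.
  rewrite -edist_cevian; apply: hull3_diameter; rewrite edist_cevian.
    by rewrite edist_base baseE; exact: box_cevian_gt.
  by rewrite edist_foot0; exact: box_cevian_ge.
rewrite -edist_leg; apply: hull3_diameter; rewrite edist_leg.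
  by rewrite (edistC _ (zigzag n.+2)) edist_cevian (le_trans (ltW cevian_lt)).
by rewrite edist_foot1 (le_trans _ leg_ge) //; exact: box_stub_le.
Qed.

(** The triangle [CPA] before the cevian cuts it. *)
Definition block n : set (R * R) :=
  convex_hull3 (zigzag n) (zigzag n.+1) (zigzag n.+2).

Lemma tile_block n ty : tile n ty `<=` block n.
Proof.
have /andP[c_ge c_le] := cut_bounds n.
case: ty => p; rewrite /tile /block => /hull3P[x [y [z [x0 y0' z0 e [e1 e2]]]]]; apply/hull3P.
  exists (x * (1 - cut n) + z), (x * cut n), y; split => //.
  - by rewrite addr_ge0 // mulr_ge0 //; lra.
  - by rewrite mulr_ge0 //; lra.
  - by rewrite -[RHS]e; ring.
  - by rewrite e1 e2 /foot /zigzag /= !abscissaS !parS; split; ring.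
exists (z * (1 - cut n)), (x + z * cut n), y; split => //.
- by rewrite mulr_ge0 //; lra.
- by rewrite addr_ge0 // mulr_ge0 //; lra.
- by rewrite -[RHS]e; ring.
- by rewrite e1 e2 /foot /zigzag /= !abscissaS !parS; split; ring.
Qed.

Lemma block_height n p : block n p -> 0 <= 0 * p.1 + 1 * p.2 + - y0 /\
  0 <= 0 * p.1 + (- 1) * p.2 + (h + y0).
Proof.
have hh : 0 <= h by rewrite /hgt; lra.
move=> bp; split; apply: (hull3_affine_ge0 _ _ _ _ _ _ _ _ bp); rewrite /zigzag /= ?parS;
  by case: (par_cases n) => ->; lra.
Qed.

Definition slant m : R := - (off m * (1 - 2 * par m) / h).
Definition shift m : R :=
  - abscissa m - off m * par m + off m * (1 - 2 * par m) * y0 / h.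
(* Vanishes on the line through [zigzag m] and [zigzag m.+1]. *)
Definition side m p : R := s * p.1 + slant m * p.2 + shift m.

Let hn0 : h != 0.
Proof. by rewrite /hgt gt_eqF //; lra. Qed.

Lemma side_strip m x y : side m (s * x, h * y + y0) =
  x - abscissa m - off m * (par m + (1 - 2 * par m) * y).
Proof.
rewrite /side /slant /shift /= mulrA -expr2 s1 mul1r.
by field.
Qed.

Lemma side_zigzag0 m : side m (zigzag m) = 0.
Proof. by rewrite side_strip; case: (par_cases m) => ->; ring. Qed.

Lemma side_zigzag1 m : side m (zigzag m.+1) = 0.
Proof. by rewrite side_strip abscissaS parS; case: (par_cases m) => ->; ring. Qed.

Lemma side_zigzag2 m k : side m (zigzag k.+2) = side m (zigzag k) + base k.
Proof. by rewrite !side_strip !abscissaS !parS /base; ring. Qed.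

Let base_ge0 n : 0 <= base n.
Proof. by have := base_ge n; lra. Qed.

(** [side m] vanishes at [m] and [m.+1] and grows by [base] every two steps, hence an induction in
    steps of two; [side_le0] runs it backwards. *)
Lemma side_ge0 m k : (m <= k)%N -> 0 <= side m (zigzag k).
Proof.
move=> /subnK <-; rewrite addnC; elim/ltn_ind: (k - m)%N => -[|[|i]] IH.
- by rewrite addn0 side_zigzag0.
- by rewrite addn1 side_zigzag1.
- by rewrite !addnS side_zigzag2 addr_ge0 // IH.
Qed.

Lemma side_le0 m k : (k <= m.+1)%N -> side m (zigzag k) <= 0.
Proof.
move=> /subnK; move: (m.+1 - k)%N => d; elim/ltn_ind: d k => d IH k.
case: d IH => [|[|d]] IH e.
- by move: e; rewrite add0n => ->; rewrite side_zigzag1.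
- by move: e; rewrite add1n => -[->]; rewrite side_zigzag0.
- have := IH d (ltnW (ltnSn _)) k.+2; rewrite -e !addnS !addSn side_zigzag2 => /(_ erefl).
  by have := base_ge0 k; lra.
Qed.

Lemma block_side_ge0 m n p : (m <= n)%N -> block n p -> 0 <= side m p.
Proof.
move=> mn bp; apply: (hull3_affine_ge0 _ _ _ _ _ _ _ _ bp); apply: side_ge0 => //;
  by rewrite ?(leqW mn) // ?(leqW (leqW mn)).
Qed.

Lemma block_side_le0 m n p : (n < m)%N -> block n p -> side m p <= 0.
Proof.
move=> nm bp; rewrite -oppr_ge0.
have E q : - side m q = - s * q.1 + - slant m * q.2 + - shift m by rewrite /side; ring.
rewrite E; apply: (hull3_affine_ge0 _ _ _ _ _ _ _ _ bp); rewrite -E oppr_ge0; apply: side_le0;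
  by rewrite ?ltnS // ltnW // ?ltnS // ltnW.
Qed.

Let s_neq0 : s != 0.
Proof. by apply/eqP => s0; move: s1; rewrite s0 expr0n /= => /eqP; rewrite eq_sym oner_eq0. Qed.

(** The line through [zigzag n] and [zigzag n.+1] has all earlier blocks on one side and [block n]
    on the other. *)
Lemma interior_block m n : (m < n)%N -> (block m)° `&` (block n)° = set0.
Proof.
move=> mn; rewrite setIC; apply: (interior_sep _ _ _ s (slant n) (shift n)).
- by rewrite xpair_eqE negb_and s_neq0.
- by move=> p /(block_side_ge0 n) H; apply: H.
- by move=> p /(block_side_le0 n) H; apply: H.
Qed.

Lemma interior_tile n : (tile n true)° `&` (tile n false)° = set0.
Proof.
have /andP[c_ge c_le] := cut_bounds n.
(* The separating line carries the cevian; the sign [e] makes the function nonnegative at [C]. *)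
pose f := foot n; pose z := zigzag n.+2; pose e := - (s * (1 - 2 * par n)).
have e2 : e * e = 1 by rewrite -expr2 sqrrN exprMn s1 sgn mul1r.
pose u := - e * (z.2 - f.2); pose v := e * (z.1 - f.1).
pose w := e * ((z.2 - f.2) * f.1 - (z.1 - f.1) * f.2).
have E p : u * p.1 + v * p.2 + w = e * cross R f z p by rewrite /u /v /w /cross; ring.
have hh : 0 <= h by rewrite /hgt; lra.
have b0 := base_ge0 n.
have near : 0 <= e * cross R f z (zigzag n).
  rewrite cross_near mulrA e2 mul1r mulr_ge0 // mulr_ge0 //; lra.
have far : e * cross R f z (zigzag n.+1) <= 0.
  have -> : cross R f z (zigzag n.+1) = - cross R (zigzag n.+1) z f by rewrite /cross; ring.
  by rewrite cross_far mulrN mulrA e2 mul1r oppr_le0 mulr_ge0 // mulr_ge0 //; lra.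
apply: (interior_sep _ _ _ u v w).
- apply/eqP => -[u0 v0]; have := E (zigzag n); rewrite u0 v0 !mul0r !add0r => w1.
  have := E f; rewrite u0 v0 !mul0r !add0r w1 cross_near mulrA e2 mul1r.
  have -> : cross R f z f = 0 by rewrite /cross; ring.
  have c0 : cut n != 0 by rewrite gt_eqF //; lra.
  have b1 : base n != 0 by have := base_ge n => ?; rewrite gt_eqF //; lra.
  by rewrite mulr0 => /eqP; rewrite mulf_eq0 (negPf hn0) mulf_eq0 (negPf c0) (negPf b1).
- move=> p hp; apply: (hull3_affine_ge0 _ _ _ _ _ _ _ _ hp); rewrite E ?near //.
    by rewrite [cross R f z f](_ : _ = 0) ?mulr0 // /cross; ring.
  by rewrite [cross R f z z](_ : _ = 0) ?mulr0 // /cross; ring.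
- move=> p hp; rewrite -oppr_ge0.
  have E' q : - (u * q.1 + v * q.2 + w) = - u * q.1 + - v * q.2 + - w by ring.
  rewrite E'; apply: (hull3_affine_ge0 _ _ _ _ _ _ _ _ hp); rewrite -E' E oppr_ge0 //.
    by rewrite [cross R f z z](_ : _ = 0) ?mulr0 // /cross; ring.
  by rewrite [cross R f z f](_ : _ = 0) ?mulr0 // /cross; ring.
Qed.

Lemma tile_cover (x y : R) : 0 <= y <= 1 -> off 0 * y <= x ->
  exists n ty, tile n ty (s * x, h * y + y0).
Proof.
move=> /andP[y_ge y_le] x_ge.
(* [lev n] is the relative height above the boundary line of [zigzag n], and [xi n] is where the
   line of [side n] meets the horizontal through the point. Two steps advance [xi] by at least
   [1 / 12]. *)
pose lev n := par n + (1 - 2 * par n) * y.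
pose xi n := abscissa n + off n * lev n.
have lev01 n : 0 <= lev n /\ 0 <= 1 - lev n.
  by rewrite /lev; case: (par_cases n) => ->; split; lra.
have levS n : lev n.+1 = 1 - lev n by rewrite /lev parS; ring.
have xiS n : xi n.+1 = xi n + base n * (1 - lev n).
  by rewrite /xi abscissaS levS /base; ring.
have xi0 : xi 0 = off 0 * y.
  by rewrite /xi /lev /abscissa big_ord0 /par /= mulr0 subr0 mul1r !add0r.
have xi_ge k : off 0 * y + k%:R * (1 / 12) <= xi k.*2.
  elim: k => [|k IH].
    by rewrite mul0r addr0 xi0.
  rewrite doubleS !xiS levS -natr1.
  have [l0 l1] := lev01 k.*2.
  have := ler_wpM2r l1 (base_ge k.*2); have := ler_wpM2r l0 (base_ge k.*2.+1).
  by move: IH; rewrite (_ : 1 - (1 - lev k.*2) = lev k.*2); [move=> *; lra|ring].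
have ex : exists n, x < xi n.
  have [k hk] : exists k : nat, 12 * (x - off 0 * y) < k%:R.
    exists (Num.bound (12 * (x - off 0 * y))).
    by apply: archi_boundP; rewrite mulr_ge0 // subr_ge0.
  by exists k.*2; apply: lt_le_trans (xi_ge k); lra.
(* The point lies in the block just before the first [xi] exceeding [x]. *)
case: (ex_minnP ex) => -[|n]; first by rewrite xi0 ltNge x_ge.
move=> x_lt /(_ n) x_min.
have {}x_min : xi n <= x.
  by rewrite leNgt; apply/negP => /x_min; rewrite ltnn.
exists n.
have b_gt0 : 0 < base n by have := base_ge n; lra.
have bn0 : base n != 0 by rewrite gt_eqF.
pose t := cut n; have /andP[t_ge t_le] := cut_bounds n; rewrite -/t in t_ge t_le.
have t0 : t != 0 by rewrite gt_eqF //; lra.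
have t1 : 1 - t != 0 by rewrite gt_eqF //; lra.
have [l0 l1] := lev01 n.
(* The barycentric coordinates with respect to [C], [P], [A] are [w], [lev n], [z]; comparing
   [lev n : w] with [t : 1 - t] tells the side of the cevian. *)
pose z := (x - xi n) / base n; pose w := 1 - lev n - z.
have z0 : 0 <= z by rewrite divr_ge0 // subr_ge0.
have w0 : 0 <= w.
  rewrite /w /z subr_ge0 ler_pdivrMr // lerBlDl mulrC -xiS; exact: ltW.
have xE : x = abscissa n + lev n * off n + z * base n.
  by rewrite /z mulfVK // /xi; ring.
have yE : y = par n + (1 - 2 * par n) * lev n.
  by rewrite /lev; case: (par_cases n) => ->; ring.
have [wt|wt] := leP (lev n * (1 - t)) (w * t).
  exists true; apply/hull3P; exists (lev n / t), z, (w - lev n * (1 - t) / t); split => //.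
  - by rewrite divr_ge0 //; lra.
  - by rewrite subr_ge0 ler_pdivrMr //; lra.
  - by rewrite /w; field.
  - rewrite /foot /zigzag -/t /= !abscissaS !parS; split.
      by rewrite {1}xE /base /w; field.
    by rewrite {1}yE /w; field.
exists false; apply/hull3P; exists (lev n - w * t / (1 - t)), z, (w / (1 - t)); split => //.
- by rewrite subr_ge0 ler_pdivrMr ?ltW //; lra.
- by rewrite divr_ge0 //; lra.
- by rewrite /w; field.
- rewrite /foot /zigzag -/t /= !abscissaS !parS; split.
    by rewrite {1}xE /base /w; field.
  by rewrite {1}yE /w; field.
Qed.

End HalfStrip.

(** * Putting the half-strips together *)

Section Assembly.
Variable R : realType.
Local Notation h := (hgt R).
Variable next : R -> R.
Hypothesis nextP : forall x, lo R <= x <= top R ->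
  lo R <= next x <= hi R /\ bal R x (next x) = 0.

Definition state (x : R) n := iter n next x.

Let start_box (x : R) : 80 / 81 <= x <= top R -> lo R <= x <= top R.
Proof.
by move=> /andP[x_ge ->]; rewrite andbT; apply: le_trans x_ge; rewrite /lo; lra.
Qed.

Lemma state_range x n : 80 / 81 <= x <= top R -> lo R <= state x n <= top R.
Proof.
move=> hx; elim: n => [|n IH]; first exact: start_box.
have [/andP[b_ge b_le] _] := nextP _ IH; apply/andP; split; first exact: b_ge.
by apply: (le_trans b_le); rewrite /hi /top; lra.
Qed.

Lemma state_tail x n : 80 / 81 <= x <= top R -> lo R <= state x n.+1 <= hi R.
Proof. by move=> hx; have [] := nextP _ (state_range _ n hx). Qed.

Lemma state_bal x n : 80 / 81 <= x <= top R -> bal R (state x n) (state x n.+1) = 0.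
Proof. by move=> hx; have [] := nextP _ (state_range _ n hx). Qed.

Lemma start_neq_state x y n : 80 / 81 <= x <= top R -> 80 / 81 <= y <= top R ->
  x = state y n.+1 -> False.
Proof.
move=> /andP[x_ge _] hy e; have /andP[_] := state_tail _ n hy.
by rewrite -e; move: x_ge; rewrite /hi; lra.
Qed.

(** [bal_inj] steps both sequences back together; neither can reach its start first, as starts
    exceed [hi]. *)
Lemma state_inj x y m n : 80 / 81 <= x <= top R -> 80 / 81 <= y <= top R ->
  state x m = state y n -> x = y /\ m = n.
Proof.
move=> hx hy; elim: m n => [|m IH] [|n].
- by [].
- by move=> /start_neq_state H; case: (H hx hy).
- by move=> /esym/start_neq_state H; case: (H hy hx).
move=> e; have [] := IH n; last by move=> -> ->.
have /andP[_ u1] := state_range _ m hx; have /andP[_ u2] := state_range _ n hy.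
apply: (bal_inj _ _ _ _ u1 u2 (state_tail _ m hx)).
by rewrite state_bal // e state_bal.
Qed.

(** The injection [pickle] of the integers into [nat] gives every strip its own value in the
    interval from 1 to [top = 1 + 1 / 80]. *)
Definition gap (j : int) : R := 1 + (80 + pickle j)%:R^-1.
Definition start (js : int * bool) : R := if js.2 then gap js.1 else (gap js.1)^-1.

Lemma gap_range j : 1 < gap j <= top R.
Proof.
rewrite /gap ltrDl invr_gt0 ltr0n addSn /=.
have -> : top R = 1 + 80%:R^-1 by rewrite /top; field.
by rewrite lerD2l lef_pV2 ?posrE ?ltr0n ?addSn // ler_nat leq_addr.
Qed.

Lemma gapV_lt1 j : (gap j)^-1 < 1.
Proof. by rewrite invf_lt1; case/andP: (gap_range j) => // g1 _; apply: lt_trans g1. Qed.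

Lemma gap_inj : injective gap.
Proof.
move=> j k /addrI/invr_inj/eqP; rewrite eqr_nat eqn_add2l => /eqP.
exact: (pcan_inj pickleK).
Qed.

Lemma start_range js : 80 / 81 <= start js <= top R.
Proof.
case: js => j []; rewrite /start /=; case/andP: (gap_range j) => g1 g2.
  by rewrite g2 andbT; lra.
have g0 : 0 < gap j by exact: lt_trans g1.
apply/andP; split; last by have := gapV_lt1 j; rewrite /top; lra.
rewrite -(invf_div 81 80) lef_pV2 ?posrE //.
Qed.

Lemma start_inj : injective start.
Proof.
move=> [j b] [k c]; rewrite /start /=.
have [] := (andP (gap_range j), andP (gap_range k)) => -[j1 _] [k1 _].
have := gapV_lt1 j; have := gapV_lt1 k.
case: b; case: c => kV jV e.
- by rewrite (gap_inj _ _ e).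
- by exfalso; lra.
- by exfalso; lra.
- by rewrite (gap_inj _ _ (invr_inj e)).
Qed.

(** Strip, right or left half, block, and tile in the block. *)
Definition index := (int * bool * (nat * bool))%type.
Definition sign (b : bool) : R := if b then 1 else -1.
Definition level (j : int) : R := h * j%:~R.
Definition states (i : index) : nat -> R := state (start i.1).
Definition ptile (i : index) : set (R * R) :=
  tile R (states i) (sign i.1.2) (level i.1.1) i.2.1 i.2.2.
Definition pdiam (i : index) : R := tile_diam R (states i) i.2.1 i.2.2.

Lemma sign_sqr b : sign b ^+ 2 = 1.
Proof. by case: b; rewrite /sign; ring. Qed.

Let rng i n : lo R <= states i n <= top R.
Proof. exact: state_range (start_range _). Qed.
Let tl i n : lo R <= states i n.+1 <= hi R.
Proof. exact: state_tail (start_range _). Qed.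
Let bl i n : bal R (states i n) (states i n.+1) = 0.
Proof. exact: state_bal (start_range _). Qed.

Lemma ptile_diameter i : has_diameter R (ptile i) (pdiam i).
Proof. exact: tile_diameter (sign_sqr _) (rng _) (tl _) (bl _) _ _. Qed.

Lemma states_inj i i' n n' : states i n = states i' n' -> i.1 = i'.1 /\ n = n'.
Proof.
by move=> /(state_inj _ _ _ _ (start_range _) (start_range _))[/start_inj ->].
Qed.

Lemma pdiam_inj : injective pdiam.
Proof.
have cev i n : cevian R (states i) n < h by exact: box_cevian_lt.
have leg i n : h <= h / 2 * (states i n.+1 + (states i n.+1)^-1).
  by apply: box_leg_ge; case/andP: (tl i n).
have half0 : h / 2 != 0 by rewrite gt_eqF // /hgt; lra.
move=> i i'; rewrite /pdiam /tile_diam.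
case: i i' => [js [n []]] [js' [n' []]] /= e.
- have {}e : (states (js, (n, true)) n)^-1 + (states (js, (n, true)) n.+1)^-1 =
    (states (js', (n', true)) n')^-1 + (states (js', (n', true)) n'.+1)^-1.
    by move: e; rewrite /cevian => /subrI/(mulfI half0).
  have := bal_sumV_inj _ _ _ _ _ (rng _ _) (rng _ _) (tl _ _) (tl _ _)
    (bl _ _) (bl _ _) e.
  by move=> /states_inj[/= -> ->].
- by have := cev (js, (n, true)) n; rewrite e ltNge leg.
- by have := cev (js', (n', true)) n'; rewrite -e ltNge leg.
- move/(mulfI half0): e.
  have := tl (js, (n, false)) n; have := tl (js', (n', false)) n'.
  set x := states _ _; set y := states _ _ => /andP[x_ge x_le] /andP[y_ge y_le] e.
  have lo0 : 0 < lo R by rewrite /lo; lra.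
  have x0 := lt_le_trans lo0 x_ge; have y0 := lt_le_trans lo0 y_ge.
  have xy1 : 1 - x * y != 0.
    have xy_le := ler_pM (ltW x0) (ltW y0) x_le y_le.
    by rewrite gt_eqF // subr_gt0 (le_lt_trans xy_le) // /hi; lra.
  (* [x + x^-1] takes equal values only at [x] and [x^-1], and [x * y <= hi ^+ 2 < 1] excludes the
     latter. *)
  have : (x - y) * (1 - x * y) = 0.
    have -> : (x - y) * (1 - x * y) = x * y * ((y + y^-1) - (x + x^-1)).
      by field; rewrite !gt_eqF.
    by rewrite e subrr mulr0.
  move/eqP; rewrite mulf_eq0 (negPf xy1) orbF subr_eq0 => /eqP /states_inj[/= <-].
  by move=> [<-].
Qed.

Lemma ptile_cover p : exists i, ptile i p.
Proof.
have h0 : 0 < h by rewrite /hgt; lra.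
have hn0 : h != 0 by rewrite gt_eqF.
pose j := Num.floor (p.2 / h); pose y := p.2 / h - j%:~R.
have y01 : 0 <= y <= 1.
  by have := floor_itv (p.2 / h); rewrite -/j intrD /y => /andP[? ?]; apply/andP; split; lra.
have pE : p.2 = h * y + level j by rewrite /y /level; field.
have cov b x : p.1 = sign b * x ->
    off R (state (start (j, b))) 0 * y <= x -> exists i, ptile i p.
  move=> p1 hx; have [n [ty]] := tile_cover _ (states (j, b, (0%N, true))) (sign b)
    (level j) (rng _) (tl _) _ _ y01 hx.
  by rewrite -p1 -pE -surjective_pairing => H; exists (j, b, (n, ty)).
have [hx|hx] := leP (off R (state (start (j, true))) 0 * y) p.1.
  by apply: (cov true) hx; rewrite /sign mul1r.
apply: (cov false (- p.1)); first by rewrite /sign; ring.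
(* Inverting the starting value negates [off], so the mirrored left half begins on the line where
   the right half begins. *)
have -> : off R (state (start (j, false))) 0 = - off R (state (start (j, true))) 0.
  by rewrite /off /state /start /= invrK; ring.
by rewrite mulNr lerN2 ltW.
Qed.

Let blk (i : index) := block R (states i) (sign i.1.2) (level i.1.1) i.2.1.

Let sub i : ptile i `<=` blk i.
Proof. exact: tile_block. Qed.

(** Tiles are separated by a horizontal line between strips, by the common first line of the two
    halves, by a [side] line between blocks, or by a cevian. *)
Lemma interior_ptile i i' : (ptile i)° `&` (ptile i')° !=set0 -> i = i'.
Proof.
have strips k k' : (k.1.1 < k'.1.1)%R -> (ptile k')° `&` (ptile k)° = set0.
  move=> lt; apply: (interior_sep _ _ _ 0 1 (- level k'.1.1)).
  - by rewrite xpair_eqE oner_eq0 andbF.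
  - by move=> p /sub /block_height [].
  - move=> p /sub /block_height [_].
    have le : (k.1.1 + 1)%:~R <= k'.1.1%:~R :> R by rewrite ler_int lezD1.
    by move: le; rewrite intrD /level /hgt; lra.
have sides j m m' : (ptile (j, true, m))° `&` (ptile (j, false, m'))° = set0.
  pose i0 : index := (j, true, m); pose i1 : index := (j, false, m').
  have E p : side R (states i1) (sign false) (level j) 0 p =
      - side R (states i0) (sign true) (level j) 0 p.
    rewrite /side /slant /shift /off /states /state /start /= /abscissa.
    rewrite !big_ord0 /par /= invrK.
    by rewrite /sign; ring.
  apply: (interior_sep _ _ _ (sign true) (slant R (states i0) 0)
    (shift R (states i0) (level j) 0)).
  - by rewrite xpair_eqE oner_eq0.
  - move=> p /sub bp.
    exact: (block_side_ge0 _ _ _ _ (sign_sqr _) (rng i0) (tl i0) _ _ _ (leq0n _) bp).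
  - move=> p /sub bp; rewrite -oppr_ge0.
    have := block_side_ge0 _ _ _ _ (sign_sqr _) (rng i1) (tl i1) _ _ _ (leq0n _) bp.
    by rewrite E.
move: i i' => [[j b] [n ty]] [[j' b'] [n' ty']].
have [lt|lt|<-] := ltgtP j j'; [by rewrite setIC strips // => -[]|by rewrite strips // => -[]|].
have [<-|] := eqVneq b b'; last first.
  by case: b b' => -[] // _; [rewrite sides => -[]|rewrite setIC sides => -[]].
have blocks (k k' : index) : k.1 = k'.1 -> (k.2.1 < k'.2.1)%N ->
    (ptile k)° `&` (ptile k')° = set0.
  move=> e lt; rewrite -subset0.
  apply: (@subset_trans _ ((blk k)° `&` (blk k')°)).
    by apply: setISS; apply: interiorS; exact: sub.
  have -> : blk k' = block R (states k) (sign k.1.2) (level k.1.1) k'.2.1.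
    by rewrite /blk /states e.
  by rewrite (interior_block _ _ _ _ (sign_sqr _) (rng k) (tl k) _ _ lt).
have [lt|lt|<-] := ltngtP n n'.
- by rewrite blocks // => -[].
- by rewrite setIC blocks // => -[].
have halves : (ptile (j, b, (n, true)))° `&` (ptile (j, b, (n, false)))° = set0.
  exact: (interior_tile _ _ _ _ (sign_sqr _) (rng (j, b, (n, true))) (tl _)).
by case: ty ty' => -[] //; [rewrite halves => -[]|rewrite setIC halves => -[]].
Qed.

End Assembly.

Theorem theorem2 (R : realType) :
  exists (eps : R) (F : set (set (R * R))),
    [/\ 0 < eps,
        tiling F,
        forall T, F T -> is_triangle T,
        forall T T', F T -> F T' -> T <> T' -> ~ congruent T T'
      & forall T, F T -> has_perimeter T 1 /\ (eps%:E <= area T)%E].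
Proof.
have /choice[next nextP] (x : R) : exists y, lo R <= x <= top R ->
    lo R <= y <= hi R /\ bal R x y = 0.
  (* The value 0 is a mere default outside the interval. *)
  have [hx|_] := boolP (lo R <= x <= top R); last by exists 0.
  by have [y] := bal_root _ _ hx; exists y.
pose d : R := 1 / 320; have d0 : 0 < d by rewrite /d; lra.
exists ((d / 3) ^+ 2), (range (ptile R next)).
have tri i : exists p q r, [/\ ptile R next i = convex_hull3 p q r,
    d <= `|cross R p q r| & Defs.edist p q + Defs.edist q r + Defs.edist r p = 1].
  have hs := start_range R i.1.
  exact: tile_triangle (sign_sqr _ _) (fun n => state_range _ _ nextP _ n hs)
    (fun n => state_tail _ _ nextP _ n hs) (fun n => state_bal _ _ nextP _ n hs) _ _.
have cross_neq0 (p q r : R * R) : d <= `|cross R p q r| -> cross R p q r != 0.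
  by move=> dle; rewrite -normr_gt0 (lt_le_trans d0).
split.
- by rewrite exprn_gt0 // divr_gt0.
- split.
  + by move=> _ [i _ <-]; have [p [q [r [-> dle _]]]] := tri i; apply/closed_hull3/cross_neq0.
  + apply/seteqP; split=> // p _; have [i ip] := ptile_cover _ _ nextP p.
    by exists (ptile R next i) => //; exists i.
  + by move=> _ _ [i _ <-] [j _ <-] /(interior_ptile _ _ nextP) ->.
- move=> _ [i _ <-]; have [p [q [r [-> dle _]]]] := tri i; exists p, q, r; split=> //.
  by move=> /collinear_cross e; have := cross_neq0 _ _ _ dle; rewrite e eqxx.
(* Congruent tiles have equal diameters, hence equal indices. *)
- move=> _ _ [i _ <-] [j _ <-] ij cong; apply: ij; congr ptile.
  apply: (pdiam_inj _ _ nextP).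
  by apply: congruent_diameter cong _ _; exact: ptile_diameter.
- move=> _ [i _ <-]; have [p [q [r [-> dle per]]]] := tri i; split.
    exists p, q, r; split=> //; split=> //.
    by move=> /collinear_cross e; have := cross_neq0 _ _ _ dle; rewrite e eqxx.
  exact: area_hull3_ge dle per.
Qed.
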